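(* Let $f:M\to M$ be a continuous map on a compact, finite-dimensional manifold $M$, and let $\Phi=\{\phi_n\}_{n\ge 1}$ be a subadditive potential on $M$. If for every observable measure $\mu\in\mathcal O_f$ the growth rates satisfy $$\Phi^*(x):=\lim_{n\to\infty}\frac1n\phi_n(x)<0\quad\text{for }\mu\text{-a.e. }x\in M,$$ then $\widetilde\Phi^*(x)<0$ for Lebesgue almost all $x\in M$.
   Context: Lebesgue measure means a normalized Lebesgue measure $m$ on $M$. $\mathcal M$ denotes the set of all Borel probability measures on $M$ with the weak$^*$ topology, and $\mathrm{dist}^*$ is a fixed metric on $\mathcal M$ inducing this topology. $\mathcal N_\epsilon(\mu)$ is the $\epsilon$-neighborhood of $\mu\in\mathcal M$ in the metric $\mathrm{dist}^*$. For $x\in M$, the empirical measures are $\delta_{x,n}=\frac1n\sum_{j=0}^{n-1}\delta_{f^j(x)}$, where $\delta_y$ is the Dirac measure at $y$. $\mathcal V_f(x)$ is the set of all weak$^*$ limits of convergent subsequences of $(\delta_{x,n})_{n\ge1}$. A measure $\mu\in\mathcal M$ is observable for $f$ if for all $\epsilon>0$ the set $A_\epsilon(\mu)=\{x\in M:\mathcal V_f(x)\cap\mathcal N_\epsilon(\mu)\neq\emptyset\}$ has positive Lebesgue measure. $\mathcal O_f$ is the set of all observable measures for $f$. (Observable measures are $f$-invariant.) A subadditive potential on $M$ is a sequence $\Phi=\{\phi_n\}_{n\ge1}$ of continuous real functions on $M$ with $\phi_{n+m}(x)\le\phi_n(x)+\phi_m(f^n x)$ for all $x\in M$ and $n,m\in\mathbb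 N$ (positive integers). By Kingman's subadditive ergodic theorem the limit $\Phi^*(x)$ exists (possibly $-\infty$) for $\mu$-a.e. $x$, for every $f$-invariant probability $\mu$. The largest growth rate at any $x\in M$ is $\widetilde\Phi^*(x):=\limsup_{n\to\infty}\frac1n\phi_n(x)$. *)

(* Defs.v *)
From HB Require Import structures.
From mathcomp Require Import all_boot all_order all_algebra.
From mathcomp Require Import all_classical all_reals all_analysis.

Set Implicit Arguments.
Unset Strict Implicit.
Unset Printing Implicit Defensive.
Import Order.TTheory GRing.Theory Num.Theory.
Import numFieldNormedType.Exports.

Local Open Scope classical_set_scope.
Local Open Scope ring_scope.

Notation borel M := (g_sigma_algebraType (@open M)).

(* Lebesgue measure only makes sense up to C^1 changes of
    coordinates, so the weakest structure considered is a C^1 atlas. *)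

Record chart (R : realType) (M : topologicalType) (d : nat) := Chart {
  chart_dom : set M ;
  chart_map : M -> 'rV[R]_d ;
  chart_inv : 'rV[R]_d -> M }.

Definition chart_img (R : realType) (M : topologicalType) (d : nat)
    (c : chart R M d) : set 'rV[R]_d :=
  chart_map c @` chart_dom c.

(* [chart_map] and [chart_inv] are total functions, meaningful only on
   [chart_dom] and [chart_img]. *)
Definition is_chart (R : realType) (M : topologicalType) (d : nat)
    (c : chart R M d) : Prop :=
  [/\ open (chart_dom c), open (chart_img c),
      {within chart_dom c, continuous (chart_map c)},
      {within chart_img c, continuous (chart_inv c)} &
      {in chart_dom c, cancel (chart_map c) (chart_inv c)}].

(* meant for open U *)
Definition C1_on (R : realType) (d : nat) (U : set 'rV[R]_d)
    (g : 'rV[R]_d -> 'rV[R]_d) : Prop :=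
  (forall y, U y -> differentiable g y) /\
  {within U, continuous (jacobian g)}.

Definition C1_atlas (R : realType) (M : topologicalType) (d : nat)
    (A : set (chart R M d)) : Prop :=
  [/\ forall c, A c -> is_chart c,
      forall x, exists2 c, A c & chart_dom c x &
      forall c c', A c -> A c' ->
        C1_on (chart_map c @` (chart_dom c `&` chart_dom c'))
              (chart_map c' \o chart_inv c)].

Definition compact_manifold (R : realType) (M : topologicalType) (d : nat)
    (A : set (chart R M d)) : Prop :=
  [/\ compact [set: M], hausdorff_space M, @second_countable M & C1_atlas A].

(* The integral of a nonnegative Borel function against d-dimensional Lebesgue
   measure, as an iterated integral (Tonelli). *)
Fixpoint lebesgue_int (R : realType) (d : nat) :
    ('rV[R]_d -> \bar R) -> \bar R :=
  match d with
  | 0 => fun F => F 0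
  | d'.+1 => fun F => (\int[@lebesgue_measure R]_t
      lebesgue_int (fun v : 'rV[R]_d' =>
        F (row_mx (const_mx t : 'rV[R]_1) v)))%E
  end.

(* m is a volume: in every chart it has a positive continuous density with
   respect to d-dimensional Lebesgue measure. *)
Definition lebesgue_on (R : realType) (M : ptopologicalType) (d : nat)
    (A : set (chart R M d)) (m : probability (borel M) R) : Prop :=
  forall c, A c -> exists rho : 'rV[R]_d -> R,
    [/\ {within chart_img c, continuous rho},
        forall y, chart_img c y -> 0 < rho y &
        forall B : set (borel M), measurable B -> B `<=` chart_dom c ->
          m B = lebesgue_int (fun y => (rho y * \1_(chart_map c @` B) y)%:E)].

Definition integrals (R : realType) (M : ptopologicalType)
    (mu : probability (borel M) R) : {ptws continuousType M R -> R} :=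
  fun g => \int[mu]_x g x.

(* the coarsest topology making mu |-> \int g dmu continuous for all continuous
   g *)
Notation weakstar R M := (initial_topology (@integrals R M)).

Section dist_neighborhood.
Context (R : realType) (M : ptopologicalType).
Variable dist : probability (borel M) R -> probability (borel M) R -> R.

Definition dist_nbhd (e : R) (mu : probability (borel M) R) :
    set (probability (borel M) R) := [set nu | dist mu nu < e].

(* A [probability] is a function on all subsets of M, so that two distinct ones
   may coincide as Borel measures; a metric on Borel measures separates them up
   to equality on Borel sets. *)
Definition is_metric : Prop :=
  [/\ forall mu nu, 0 <= dist mu nu,
      forall mu nu, dist mu nu = 0 <->
        (forall B : set (borel M), measurable B -> mu B = nu B),
      forall mu nu, dist mu nu = dist nu mu &
      forall mu nu xi, dist mu xi <= dist mu nu + dist nu xi].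

Definition induces_weakstar : Prop :=
  forall U : set (weakstar R M),
    open U <-> (forall mu, U mu -> exists2 e : R, 0 < e & dist_nbhd e mu `<=` U).

Definition weakstar_metric : Prop := is_metric /\ induces_weakstar.

End dist_neighborhood.

Section empirical_measure.
Context (R : realType) (M : ptopologicalType) (f : M -> M) (x : M) (n : nat).

(* The index is shifted: this is the average over the first n+1 points of the
   orbit, so that n ranges over all of nat. *)
Definition empirical : set (borel M) -> \bar R :=
  mscale ((n.+1%:R^-1 : R)%:nng)
    (msum (fun j => \d_(iter j f x : borel M)) n.+1).

HB.instance Definition _ := Measure.on empirical.

Let empirical_setT : empirical [set: borel M] = 1%E.
Proof.
rewrite /empirical /mscale /= /msum (eq_bigr (fun=> 1%E)); last first.
  by move=> j _; exact: diracT.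
by rewrite sumEFin sumr_const card_ord -EFinM mulVf// pnatr_eq0.
Qed.

HB.instance Definition _ :=
  Measure_isProbability.Build _ _ _ empirical empirical_setT.

End empirical_measure.

Definition limit_measures (R : realType) (M : ptopologicalType) (f : M -> M)
    (x : M) : set (probability (borel M) R) :=
  [set nu | exists2 s : nat -> nat, {homo s : i j / (i < j)%N} &
    ((fun k => empirical R f x (s k) : weakstar R M) @ \oo
       --> (nu : weakstar R M))].

(* For M compact and [dist] a metric for the weak* topology, the set below is
   Borel, so that its measure is meaningful. *)
Definition observable (R : realType) (M : ptopologicalType)
    (dist : probability (borel M) R -> probability (borel M) R -> R)
    (m : probability (borel M) R) (f : M -> M)
    (mu : probability (borel M) R) : Prop :=
  forall e : R, 0 < e ->
    (0 < m [set x | limit_measures f x `&` dist_nbhd dist e mu !=set0])%E.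

(* Only the functions of index n >= 1 matter. *)
Definition subadditive_potential (R : realType) (M : topologicalType)
    (f : M -> M) (phi : nat -> M -> R) : Prop :=
  (forall n, (0 < n)%N -> continuous (phi n)) /\
  (forall n p x, (0 < n)%N -> (0 < p)%N ->
     phi (n + p)%N x <= phi n x + phi p (iter n f x)).

Definition growth (R : realType) (M : Type) (phi : nat -> M -> R) (x : M)
    : nat -> \bar R :=
  fun n => (phi n x / n%:R)%:E.

(* only meaningful when [cvgn (growth phi x)] *)
Definition growth_rate (R : realType) (M : Type) (phi : nat -> M -> R)
    (x : M) : \bar R := limn (growth phi x).

Definition largest_growth_rate (R : realType) (M : Type)
    (phi : nat -> M -> R) (x : M) : \bar R := limn_esup (growth phi x).

(* Main.v *)
Require Import Defs.
From HB Require Import structures.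
From mathcomp Require Import all_boot all_order all_algebra.
From mathcomp Require Import finmap ring lra.
From mathcomp Require Import all_classical all_reals all_analysis.
From mathcomp Require Import measurable_realfun.
Import Order.TTheory GRing.Theory Num.Theory.
Import numFieldNormedType.Exports.
Local Open Scope classical_set_scope.
Local Open Scope ring_scope.
Set Implicit Arguments.
Unset Strict Implicit.
Unset Printing Implicit Defensive.

(* For almost every x, every limit measure of the orbit of x is observable: the
   empirical measures at points of a countable dense set are dense among all of
   them, so that a countable family of balls of measure-zero basin absorbs all
   non-observable limits.  If limsup phi_n(x)/n >= 0 for such an x, weak*
   compactness gives an observable mu which is the limit of empirical measures
   along times n with phi_n(x)/n > -o(1).  Subadditivity bounds N phi_n(x) by the
   orbit sum of phi_N up to a constant, so that the integral of phi_N against mu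
   is nonnegative for all N > 0.  Fatou's lemma contradicts this, since phi_N/N
   is bounded above and converges to a negative limit mu-a.e. *)

(** * Probabilities from contents *)

Lemma open_borel_measurable (M : ptopologicalType) (U : set (borel M)) :
  open (U : set M) -> measurable U.
Proof. by move=> oU; exact: sub_sigma_algebra. Qed.

Lemma closed_borel_measurable (M : ptopologicalType) (K : set (borel M)) :
  closed (K : set M) -> measurable K.
Proof.
move=> cK; rewrite -(setCK K); apply: measurableC.
by apply: open_borel_measurable; exact: closed_openC.
Qed.

Section content_regularization.
Context (R : realType) (M : ptopologicalType).
Variable c : {content set (borel M) -> \bar R}.
Local Open Scope ereal_scope.

(** The classical passage from a content to a regular Borel measure: closed sets approximate open
    ones from inside, and open sets approximate arbitrary ones from outside. The content [c] is only
    finitely additive. *)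
Definition inner_content (U : set M) : \bar R :=
  ereal_sup [set c K | K in [set K : set M | closed K /\ K `<=` U]].

Definition outer_content (A : set M) : \bar R :=
  ereal_inf [set inner_content U | U in [set U : set M | open U /\ A `<=` U]].

Lemma inner_content_ub (K U : set M) :
  closed K -> K `<=` U -> c K <= inner_content U.
Proof. by move=> cK KU; apply: ereal_sup_ubound; exists K. Qed.

Lemma inner_content_ge0 (U : set M) : 0 <= inner_content U.
Proof.
rewrite -(measure0 c); apply: inner_content_ub => //; exact: closed0.
Qed.

Lemma le_inner_content (U V : set M) :
  U `<=` V -> inner_content U <= inner_content V.
Proof.
move=> UV; apply: ge_ereal_sup => _ [K [cK KU] <-].
by apply: inner_content_ub => //; exact: subset_trans UV.
Qed.

Lemma inner_content_le (U : set M) : open U -> inner_content U <= c U.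
Proof.
move=> oU; apply: ge_ereal_sup => _ [K [cK KU] <-].
apply: le_measure => //; rewrite inE.
- exact: closed_borel_measurable.
- exact: open_borel_measurable.
Qed.

Lemma outer_content_lb (A U : set M) :
  open U -> A `<=` U -> outer_content A <= inner_content U.
Proof. by move=> oU AU; apply: ereal_inf_lbound; exists U. Qed.

Lemma outer_content_ge0 (A : set M) : 0 <= outer_content A.
Proof.
by apply: le_ereal_inf_tmp => _ [U [oU AU] <-]; exact: inner_content_ge0.
Qed.

Lemma outer_content_open (U : set M) :
  open U -> outer_content U = inner_content U.
Proof.
move=> oU; apply/eqP; rewrite eq_le outer_content_lb//=.
by apply: le_ereal_inf_tmp => _ [V [oV UV] <-]; exact: le_inner_content.
Qed.

Lemma outer_content_closed_ge (K : set M) : closed K -> c K <= outer_content K.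
Proof.
move=> cK; apply: le_ereal_inf_tmp => _ [U [oU KU] <-].
exact: inner_content_ub.
Qed.

Lemma le_outer_content : {homo outer_content : A B / A `<=` B >-> A <= B}.
Proof.
move=> A B AB; apply: le_ereal_inf_tmp => _ [U [oU BU] <-].
by apply: outer_content_lb => //; exact: subset_trans BU.
Qed.

Lemma outer_content0 : outer_content set0 = 0.
Proof.
apply/eqP; rewrite eq_le outer_content_ge0 andbT.
rewrite outer_content_open; last exact: open0.
by rewrite -(measure0 c); apply: inner_content_le; exact: open0.
Qed.

Hypothesis normal_M : normal_space M.
Hypothesis compact_M : compact [set: M].

(** Normality separates the disjoint closed sets [K] minus [U] and [K] minus [V] by disjoint open
    sets; removing one of these from [K] leaves a piece inside [U], removing the other leaves a
    piece inside [V]. *)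
Lemma closed_subset_setU (K U V : set M) : closed K -> open U -> open V ->
  K `<=` U `|` V -> exists K1 K2, [/\ closed K1, closed K2,
    K1 `<=` U, K2 `<=` V & K = K1 `|` K2].
Proof.
move=> cK oU oV KUV.
have cKU : closed (K `&` ~` U) by apply: closedI => //; exact: open_closedC.
have cKV : closed (K `&` ~` V) by apply: closedI => //; exact: open_closedC.
have KUV0 : (K `&` ~` U) `&` (K `&` ~` V) = set0.
  by rewrite -subset0 => x [[Kx nU] [_ nV]]; case: (KUV x Kx).
have [V1 [V2 [oV1 oV2 s1 s2 V12]]] :=
  (@normal_openP R M).1 normal_M _ _ cKU cKV KUV0.
exists (K `&` ~` V1), (K `&` ~` V2); split.
- by apply: closedI => //; exact: open_closedC.
- by apply: closedI => //; exact: open_closedC.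
- by move=> x [Kx nO]; apply: contrapT => nU; apply: nO; exact: s1.
- by move=> x [Kx nO]; apply: contrapT => nV; apply: nO; exact: s2.
- rewrite -setIUr -setCI V12 setC0 setIT//.
Qed.

Lemma content_le_sum_inner (F : nat -> set M) n (K : set M) :
  (forall i, open (F i)) -> closed K -> K `<=` \big[setU/set0]_(i < n) F i ->
  c K <= \sum_(i < n) inner_content (F i).
Proof.
move=> oF; elim: n K => [|n IH] K cK.
  by rewrite !big_ord0 subset0 => ->; rewrite measure0.
rewrite !big_ord_recr/= => KF.
have oB : open (\big[setU/set0]_(i < n) F i).
  by elim/big_ind : _ => //; [exact: open0|exact: openU].
have [K1 [K2 [cK1 cK2 K1F K2F ->]]] := closed_subset_setU cK oB (oF n) KF.
apply: (@le_trans _ _ (c K1 + c K2)).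
  by apply: measureU2; exact: closed_borel_measurable.
by apply: leeD; [exact: IH|exact: inner_content_ub].
Qed.

(** Compactness of a closed [K] inside the union reduces the countable cover to a finite one, where
    finite additivity of [c] suffices. *)
Lemma inner_content_sigma_subadditive (F : nat -> set M) :
  (forall i, open (F i)) ->
  inner_content (\bigcup_i F i) <= \sum_(i <oo) inner_content (F i).
Proof.
move=> oF; apply: ge_ereal_sup => _ [K [cK KF] <-].
have ccK : compact K by exact: (subclosed_compact cK compact_M).
rewrite compact_cover in ccK.
have [D _ KD] := ccK nat setT F (fun i _ => oF i) KF.
pose N := (\max_(i <- D) i).+1.
have KN : K `<=` \big[setU/set0]_(i < N) F i.
  move=> x /KD[i /= iD Fx]; rewrite -bigcup_mkord; exists i => //=.
  by rewrite ltnS; apply: leq_bigmax_seq.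
apply: le_trans (content_le_sum_inner oF cK KN) _.
rewrite -(big_mkord xpredT (fun i => inner_content (F i))).
apply: nneseries_lim_ge => *; exact: inner_content_ge0.
Qed.

Hypothesis fin_c : c setT \is a fin_num.

Lemma inner_content_fin U : inner_content U \is a fin_num.
Proof.
rewrite ge0_fin_numE ?inner_content_ge0//.
apply: (@le_lt_trans _ _ (inner_content setT)); first exact: le_inner_content.
apply: (@le_lt_trans _ _ (c setT)); first exact/inner_content_le/openT.
by rewrite ltey_eq fin_c.
Qed.

Lemma outer_content_fin A : outer_content A \is a fin_num.
Proof.
rewrite ge0_fin_numE ?outer_content_ge0//.
apply: (@le_lt_trans _ _ (inner_content setT)).
  by apply: outer_content_lb => //; exact: openT.
by rewrite ltey_eq inner_content_fin.
Qed.

Lemma outer_content_sigma_subadditive : sigma_subadditive outer_content.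
Proof.
move=> A.
suff add2e (e : {posnum R}) : outer_content (\bigcup_n A n) <=
    \sum_(i <oo) outer_content (A i) + e%:num%:E.
  by apply/lee_addgt0Pr => _/posnumP[].
rewrite (le_trans _ (epsilon_trick _ _ _))//; last first.
  by move=> n; exact: outer_content_ge0.
pose P n (U : set M) := [/\ open U, A n `<=` U &
  inner_content U <= outer_content (A n) + (e%:num / (2 ^ n.+1)%:R)%:E].
have [G PG] : {G : nat -> set M & forall n, P n (G n)}.
  apply: (@choice _ _ P) => n.
  have en : (0 < e%:num / (2 ^ n.+1)%:R)%R by [].
  have [_ [U [oU AU] <-] lU] := lb_ereal_inf_adherent en (outer_content_fin (A n)).
  by exists U; split => //; exact: ltW.
apply: (@le_trans _ _ (inner_content (\bigcup_n G n))).
  apply: outer_content_lb.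
    by apply: bigcup_open => i _; case: (PG i).
  by apply: subset_bigcup => i _; case: (PG i).
apply: le_trans (inner_content_sigma_subadditive _) _.
  by move=> i; case: (PG i).
apply: lee_nneseries => n *; first exact: inner_content_ge0.
by case: (PG n).
Qed.

(** Inside an open [W] containing [X], a closed [K] nearly exhausts [W] within [U]. Then a closed
    [L] nearly exhausts [W] minus [K], which is open and still contains [X] minus [U]. Since [K] and
    [L] are disjoint, [c K + c L] is at most the inner content of [W]. *)
Lemma open_caratheodory (U : set M) :
  open U -> outer_content.-caratheodory U.
Proof.
pose mu : {outer_measure set M -> \bar R} := HB.pack outer_content
  (isOuterMeasure.Build R M outer_content outer_content0 outer_content_ge0
     le_outer_content outer_content_sigma_subadditive).
move=> oU; apply: (@le_caratheodory_measurable _ _ mu) => X /=.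
apply: le_ereal_inf_tmp => _ [W [oW XW] <-].
apply/lee_addgt0Pr => e e0.
have e20 : (0 < e / 2)%R by rewrite divr_gt0.
have [_ [K [cK KWU] <-] lK] :=
  ub_ereal_sup_adherent e20 (inner_content_fin (W `&` U)).
have [_ [L [cL LWK] <-] lL] :=
  ub_ereal_sup_adherent e20 (inner_content_fin (W `&` ~` K)).
apply: (@le_trans _ _ (inner_content (W `&` U) + inner_content (W `&` ~` K))).
  apply: leeD; apply: outer_content_lb.
  - exact: openI.
  - exact: setSI.
  - by apply: openI => //; exact: closed_openC.
  - by move=> x [Xx nU]; split; [exact: XW|move=> /KWU[]].
have KL : c K + c L = c (K `|` L).
  rewrite measureU//; [exact: closed_borel_measurable..|].
  by rewrite -subset0 => x [Kx /LWK[_]]; exact.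
have KLW : c K + c L <= inner_content W.
  rewrite KL; apply: inner_content_ub; first exact: closedU.
  by move=> x [/KWU[]|/LWK[]].
apply: (@le_trans _ _ ((c K + (e / 2)%:E) + (c L + (e / 2)%:E))).
  by apply: leeD; rewrite -leeBlDr//; exact: ltW.
rewrite addeACA -EFinD -splitr; exact: leeD2r.
Qed.

End content_regularization.

(* Stands in for the Riesz representation theorem: regularisation can only move
   the mass of the content from open sets to closed sets. *)
Lemma content_probability (R : realType) (M : ptopologicalType)
    (c : {content set (borel M) -> \bar R}) :
  normal_space M -> compact [set: M] -> c setT = 1%E ->
  exists P : probability (borel M) R, forall U : set (borel M),
    open (U : set M) -> (P U <= c U)%E.
Proof.
move=> nM cM cT.
have fc : c setT \is a fin_num by rewrite cT.
pose mu : {outer_measure set M -> \bar R} := HB.pack (outer_content c)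
  (isOuterMeasure.Build R M _ (outer_content0 c) (outer_content_ge0 c)
     (@le_outer_content _ _ c) (outer_content_sigma_subadditive nM cM fc)).
have cara : (@measurable _ (borel M)) `<=` mu.-caratheodory.
  apply: smallest_sub; last by move=> U; exact: open_caratheodory.
  split; first exact: caratheodory_measurable_set0.
  - move=> A mA; rewrite setTD; exact: caratheodory_measurable_setC.
  - by move=> F mF; exact: caratheodory_measurable_bigcup.
have sig : semi_sigma_additive (mu : set (borel M) -> \bar R).
  move=> F mF tF mUF.
  by apply: (@caratheodory_measure_sigma_additive R M mu) => //;
    [move=> i; exact: cara|exact: cara].
pose m1 : {measure set (borel M) -> \bar R} := HB.pack
  (mu : set (borel M) -> \bar R)
  (isMeasure.Build _ (borel M) R mu (outer_content0 c) (outer_content_ge0 c) sig).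
have m1T : m1 setT = 1%E.
  rewrite /m1/=; apply/eqP; rewrite eq_le; apply/andP; split.
  - rewrite outer_content_open; last exact: openT.
    by rewrite -cT; apply: inner_content_le; exact: openT.
  - by rewrite -cT; apply: outer_content_closed_ge; exact: closedT.
pose P : probability (borel M) R := HB.pack (Measure.sort m1)
  (Measure_isProbability.Build _ (borel M) R m1 m1T).
exists P => U oU; rewrite /P/= outer_content_open//.
exact: inner_content_le.
Qed.

(** * Integrals of continuous functions *)

(** For a neighbourhood of a cluster point, an ultrafilter contains either its preimage or the
    complement of that preimage, and clustering excludes the latter. *)
Lemma ultra_bounded_cvg (R : realType) (T : Type) (F : set_system T)
    (h : T -> R) (a b : R) : UltraFilter F -> (forall x, a <= h x <= b) ->
  exists l : R, h @ F --> l.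
Proof.
move=> UF hab.
have [p [_ clp]] : `[a, b] `&` cluster (h @ F) !=set0.
  apply: segment_compact.
  by apply: nearW => x /=; rewrite in_itv/= hab.
exists p => V pV; have [//|FV] := in_ultra_setVsetC (h @^-1` V) UF.
have /clp : (h @ F) (~` V) by [].
by move=> /(_ _ pV)[y []].
Qed.

Section layer_cake.
Context (R : realType).

(** Each level [h * i.+1] strictly below [y] contributes one step [h]. Strictness matters: for
    continuous [y] the superlevel sets are open, and [content_probability] compares measures on open
    sets only. *)
Lemma layer_cake_le (h y : R) N : 0 <= h -> 0 <= y ->
  \sum_(i < N) h * (h * i.+1%:R < y)%R%:R <= y.
Proof.
move=> h0 y0; elim: N => [|N IH]; first by rewrite big_ord0.
have [Ny|yN] := ltP (h * N.+1%:R) y.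
  apply: le_trans (ltW Ny).
  rewrite -[N.+1 in leRHS]card_ord -sum1_card natr_sum mulr_sumr.
  by apply: ler_sum => i _; rewrite ler_wpM2l// lern1 leq_b1.
by rewrite big_ord_recr/= ltNge yN/= mulr0 addr0.
Qed.

Lemma layer_cake_ge (h y : R) N : 0 <= h -> y <= h * N.+1%:R ->
  y <= h + \sum_(i < N) h * (h * i.+1%:R < y)%R%:R.
Proof.
move=> h0; elim: N => [|N IH] yN.
  by rewrite big_ord0 addr0; rewrite mulr1 in yN.
have [Ny|Ny] := ltP (h * N.+1%:R) y.
  rewrite (eq_bigr (fun=> h)); last first.
    move=> i _; rewrite (_ : (_ < _) = true) ?mulr1//.
    by apply: le_lt_trans Ny; rewrite ler_wpM2l// ler_nat.
  rewrite sumr_const card_ord; apply: le_trans yN _.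
  by rewrite -mulrS mulr_natr.
by rewrite big_ord_recr/= ltNge Ny/= mulr0 addr0 IH.
Qed.

End layer_cake.

Section continuous_integral.
Context (R : realType) (M : ptopologicalType).
Hypothesis compact_M : compact [set: M].

Lemma continuous_borel_measurable (g : M -> R) :
  continuous g -> measurable_fun [set: borel M] g.
Proof.
move=> /continuousP cg.
apply: (measurability _ (RGenOpens.measurableE R)).
move=> _ [_ [a [b ->] <-]]; rewrite setTI; apply: open_borel_measurable.
exact/cg/interval_open.
Qed.

Lemma continuous_compact_bounded (g : M -> R) : continuous g ->
  exists B : R, forall x, `|g x| <= B.
Proof.
move=> cg.
have cpt : compact (g @` setT).
  by apply: continuous_compact => //; exact: continuous_subspaceT.
have [B [_ gB]] := compact_bounded cpt.
by exists (B + 1) => x; apply: (gB (B + 1)); [rewrite ltrDl|exists x].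
Qed.

Lemma continuous_integrable (P : probability (borel M) R) (g : M -> R) :
  continuous g -> P.-integrable [set: borel M] (EFin \o g).
Proof.
move=> cg; apply: measurable_bounded_integrable => //.
- by rewrite (le_lt_trans (probability_le1 _ _)) ?ltry.
- exact: continuous_borel_measurable.
- have [B gB] := continuous_compact_bounded cg.
  exists B; split; first exact: num_real.
  by move=> r Br x _ /=; exact: le_trans (gB x) (ltW Br).
Qed.

Lemma Rintegral_prob_cst (P : probability (borel M) R) (k : R) :
  \int[P]_(_ in [set: borel M]) k = k.
Proof. by rewrite Rintegral_cst// [X in fine X](@probability_setT _ _ R P)/= mulr1. Qed.

Lemma Rintegral_step (P : probability (borel M) R) (h : R)
    (U : nat -> set (borel M)) N : (forall i, measurable (U i)) ->
  P.-integrable [set: borel M] (EFin \o (fun x => \sum_(i < N) h * \1_(U i) x)) /\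
  \int[P]_x (\sum_(i < N) h * \1_(U i) x) = \sum_(i < N) h * fine (P (U i)).
Proof.
move=> mU; elim: N => [|N [iI IH]].
  split.
    apply: (eq_integrable _ (cst 0%E)) => //; last exact: integrable0.
    by move=> x _; rewrite /= big_ord0.
  by under eq_Rintegral do rewrite big_ord0; rewrite big_ord0 Rintegral_prob_cst.
have iU : P.-integrable [set: borel M] (EFin \o (fun x => h * \1_(U N) x)).
  rewrite (_ : _ \o _ = fun x => (h%:E * (\1_(U N) x)%:E)%E); last by apply/funext.
  by apply: integrableZl => //; exact: integrable_indic.
split.
  rewrite (_ : _ \o _ = fun x =>
      ((\sum_(i < N) h * \1_(U i) x)%:E + (h * \1_(U N) x)%:E)%E).
    exact: integrableD.
  by apply/funext => x /=; rewrite big_ord_recr.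
under eq_Rintegral do rewrite big_ord_recr/=.
rewrite RintegralD// IH big_ord_recr/= RintegralZl//; last exact: integrable_indic.
by rewrite /Rintegral integral_indic// setIT.
Qed.

End continuous_integral.

(** * Weak* compactness *)

Section weakstar_topology.
Context (R : realType) (M : ptopologicalType).
Local Notation prob := (probability (borel M) R).

(** The topology is pulled back from a product topology, where convergence is tested on each
    coordinate [g]. *)
Lemma weakstar_cvgP (F : set_system prob) (nu : prob) : Filter F ->
  F --> (nu : weakstar R M) <-> forall g : M -> R, continuous g ->
    (fun mu : prob => \int[mu]_x g x) @ F --> \int[nu]_x g x.
Proof.
move=> FF; split.
- move=> Fnu g cg; pose g' : continuousType M R := mkcts cg.
  have ci := @initial_continuous _ _ (@integrals R M) nu.
  have pc := @proj_continuous _ (fun _ : continuousType M R => R) g'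
    (@integrals R M nu).
  apply: (@cvg_comp _ _ _ (@integrals R M)
    (fun h : {ptws continuousType M R -> R} => h g') _ _ _ _ pc).
  exact: cvg_trans (cvg_app _ Fnu) ci.
- move=> Fg A [_ [[B oB <-] Bnu] BA].
  have : @integrals R M @ F --> @integrals R M nu.
    apply/cvg_sup => g V [_ [[W oW <-] Wnu] WV].
    apply: filterS WV _.
    by apply: (Fg g (@cts_fun _ _ g)); exact: open_nbhs_nbhs.
  move=> /(_ B) FB; apply: filterS BA _; apply: FB.
  exact: open_nbhs_nbhs.
Qed.

Hypothesis compact_M : compact [set: M].
Hypothesis normal_M : normal_space M.

(** Along an ultrafilter the mass of every Borel set converges, but the limit [c] need only be
    finitely additive. Its regularization [P] is at most [c] on open sets, so layer-cake sums bound
    the integral of [g] against [P] by the limit of the integrals; the same bound for [- g] gives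
    convergence. *)
Lemma weakstar_compact : compact [set: weakstar R M].
Proof.
rewrite compact_ultra => F UF _.
(* Non-Borel sets receive the default value 0, as [c] must be nonnegative on all sets. *)
have cvg_ev (B : set (borel M)) : {l : R | 0 <= l /\ (measurable B ->
    (fun mu : prob => fine (mu B)) @ F --> l)}.
  apply: cid; have [mB|nB] := pselect (measurable B); last by exists 0; split.
  have [l Fl] : exists l : R, (fun mu : prob => fine (mu B)) @ F --> l.
    apply: (@ultra_bounded_cvg _ _ _ _ 0 1) => mu.
    rewrite fine_ge0//= -lee_fin fineK ?probability_le1//.
    exact: fin_num_measure.
  exists l; split=> //; rewrite -(cvg_lim (@Rhausdorff R) Fl).
  apply: limr_ge; first exact: cvgP Fl.
  by apply: nearW => mu; rewrite fine_ge0.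
pose c (B : set (borel M)) := (sval (cvg_ev B))%:E.
have cE (B : set (borel M)) : measurable B ->
    (fun mu : prob => fine (mu B)) @ F --> fine (c B).
  by move=> mB; rewrite /c; exact: (svalP (cvg_ev B)).2.
have c0 B : (0 <= c B)%E by rewrite lee_fin; exact: (svalP (cvg_ev B)).1.
have cD : measure_function.semi_additive c.
  move=> G n mG tG mUG; rewrite /c sumEFin; congr EFin.
  apply/esym; apply: (@cvg_unique _ (@Rhausdorff R)
    ((fun mu : prob => fine (mu (\big[setU/set0]_(k < n) G k))) @ F)); last first.
    exact: (svalP (cvg_ev _)).2.
  have -> : (fun mu : prob => fine (mu (\big[setU/set0]_(k < n) G k))) =
      (fun mu => \sum_(k < n) fine (mu (G k))).
    apply/funext => mu; rewrite measure_semi_additive// sum_fine//.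
    by move=> k _; exact: fin_num_measure.
  apply: cvg_big => [|k _]; first exact: add_continuous.
  exact: (svalP (cvg_ev _)).2.
pose C : {content set (borel M) -> \bar R} := HB.pack c
  (isContent.Build _ (borel M) R c c0 cD).
have CT : C setT = 1%E.
  rewrite /C/= /c; congr EFin.
  apply: (@cvg_unique _ (@Rhausdorff R)
    ((fun mu : prob => fine (mu setT)) @ F)).
    exact: (svalP (cvg_ev _)).2.
  rewrite (_ : (fun mu : prob => _) = cst 1); first exact: cvg_cst.
  by apply/funext => mu /=; rewrite [X in fine X](@probability_setT _ _ R mu).
have [P PC] := content_probability normal_M compact_M CT.
have le_lim (g : M -> R) (e : R) : continuous g -> 0 < e ->
    \forall mu \near F, \int[P]_x g x <= \int[(mu : prob)]_x g x + e.
  move=> cg e0.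
  have [B gB] := continuous_compact_bounded compact_M cg.
  (* A step [h] is lost twice, by rounding in [P_step] and by the limit in [mu_c], hence [e / 2].
     Adding [B] makes [g] nonnegative with values up to [2 * B], and [N] is large enough for the
     levels to cover this range up to one step. *)
  pose h := e / 2; have h0 : 0 < h by rewrite divr_gt0.
  pose N := Num.truncn (2 * B / h).
  have gN x : g x + B <= h * N.+1%:R.
    have gB2 : g x + B <= 2 * B.
      by rewrite mulr2n mulrDl mul1r lerD2r (le_trans (ler_norm _)).
    apply: le_trans gB2 _.
    by rewrite [leRHS]mulrC -ler_pdivrMr// ltW// truncnS_gt.
  have g0 x : 0 <= g x + B.
    by rewrite -lerBlDr sub0r; have := gB x; rewrite ler_norml => /andP[].
  pose U i : set (borel M) := [set x | h * i.+1%:R < g x + B].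
  have cgB : continuous (fun x => g x + B).
    by move=> x; apply: cvgD; [exact: cg|exact: cvg_cst].
  have oU i : open (U i : set M).
    have /continuousP/(_ _ (@open_gt R (h * i.+1%:R))) := cgB.
    exact.
  have mU i : measurable (U i) by exact: open_borel_measurable.
  have indU i x : \1_(U i) x = (h * i.+1%:R < g x + B)%R%:R :> R.
    by rewrite indicE (_ : (x \in U i) = (h * i.+1%:R < g x + B))//;
      apply/idP/idP; rewrite inE.
  have intB (mu : prob) : \int[mu]_x (g x + B) = \int[mu]_x g x + B.
    rewrite RintegralD// ?Rintegral_prob_cst//.
    - exact: continuous_integrable.
    - exact: finite_measure_integrable_cst.
  have step_le (mu : prob) :
      \sum_(i < N) h * fine (mu (U i)) <= \int[mu]_x g x + B.
    have [iS <-] := Rintegral_step mu h N mU.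
    rewrite -intB; apply: le_Rintegral => //.
      exact: continuous_integrable.
    move=> x _; apply: le_trans (layer_cake_le N (ltW h0) (g0 x)).
    by apply: ler_sum => i _; rewrite indU.
  have P_step : \int[P]_x g x + B <= h + \sum_(i < N) h * fine (P (U i)).
    have [iS <-] := Rintegral_step P h N mU.
    have iC := @finite_measure_integrable_cst _ _ _ P setT h measurableT.
    rewrite -intB -[X in X + _](Rintegral_prob_cst P h) -RintegralD//.
    apply: le_Rintegral => //.
    - exact: continuous_integrable.
    - exact: (integrableD measurableT iC iS).
    - move=> x _; rewrite (le_trans (layer_cake_ge (ltW h0) (gN x)))// lerD2l.
      by apply: ler_sum => i _; rewrite indU.
  have P_c : \sum_(i < N) h * fine (P (U i)) <= \sum_(i < N) h * fine (c (U i)).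
    apply: ler_sum => i _; rewrite ler_pM2l// fine_le//; last exact: PC.
    exact: fin_num_measure.
  have cvg_c : (fun mu : prob => \sum_(i < N) h * fine (mu (U i))) @ F -->
      \sum_(i < N) h * fine (c (U i)).
    apply: cvg_big => [|i _]; first exact: add_continuous.
    by apply: cvgMr; exact: cE.
  have lt_c : \sum_(i < N) h * fine (c (U i)) - h <
      \sum_(i < N) h * fine (c (U i)) by rewrite ltrBlDr ltrDl.
  apply: filterS (cvgr_gt _ cvg_c _ lt_c) => mu mu_c.
  have := step_le mu; rewrite /h in P_step mu_c P_c *.
  lra.
exists P; split=> //; apply/weakstar_cvgP => g cg.
apply/cvgrPdist_le => e e0.
have cNg : continuous (fun x => - g x) by move=> x; apply: cvgN; exact: cg.
apply: filterS2 (le_lim _ _ cg e0) (le_lim _ _ cNg e0) => mu.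
have intN (nu : prob) : \int[nu]_x (- g x) = - \int[nu]_x g x.
  under eq_Rintegral do rewrite -mulN1r.
  by rewrite RintegralZl ?mulN1r//; exact: continuous_integrable.
by rewrite !intN ler_norml; lra.
Qed.

End weakstar_topology.

(** * Convergent subsequences for the weak* metric *)

Lemma increasing_choice (P : nat -> nat -> Prop) :
  (forall k n, exists2 j, (n <= j)%N & P k j) ->
  exists2 s : nat -> nat, {homo s : i j / (i < j)%N} & forall k, P k (s k).
Proof.
move=> HP.
have /choice[h Hh] : forall kn : nat * nat,
    exists j, (kn.2 <= j)%N /\ P kn.1 j.
  by move=> [k n]; have [j nj Pj] := HP k n; exists j.
pose s := fix s k := if k is k'.+1 then h (k, (s k').+1) else h (0, 0)%N.
exists s.
  apply: homo_ltn; first exact: ltn_trans.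
  by move=> i; exact: (Hh (i.+1, (s i).+1)).1.
by case=> [|k]; [exact: (Hh (0, 0)%N).2|exact: (Hh (k.+1, (s k).+1)).2].
Qed.

Lemma homo_ltn_ge_id (s : nat -> nat) : {homo s : i j / (i < j)%N} ->
  forall n, (n <= s n)%N.
Proof.
by move=> hs; elim=> // n IH; apply: leq_ltn_trans IH _; exact: hs.
Qed.

Section weakstar_metric.
Context (R : realType) (M : ptopologicalType).
Local Notation prob := (probability (borel M) R).
Variable dist : prob -> prob -> R.
Hypothesis dist_weakstar : weakstar_metric dist.

Lemma dist_refl mu : dist mu mu = 0.
Proof. by have [[_ d0 _ _] _] := dist_weakstar; apply/d0. Qed.

Lemma open_dist_nbhd e mu : open (dist_nbhd dist e mu : set (weakstar R M)).
Proof.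
have [[_ _ _ tri] dopen] := dist_weakstar.
apply/dopen => nu; rewrite /dist_nbhd/= => mu_nu.
exists (e - dist mu nu); first by rewrite subr_gt0.
by move=> xi /=; rewrite ltrBrDl; exact: le_lt_trans.
Qed.

Lemma weakstar_cvg_dist (F : set_system prob) (nu : prob) : Filter F ->
  F --> (nu : weakstar R M) <->
  forall e : R, 0 < e -> \forall mu \near F, dist nu mu < e.
Proof.
move=> FF; split=> [Fnu e e0|Fnu A].
  apply: Fnu; apply: open_nbhs_nbhs; split; first exact: open_dist_nbhd.
  by rewrite /dist_nbhd/= dist_refl.
rewrite nbhsE => -[U [oU Unu] UA].
have [e e0 eU] := (dist_weakstar.2 U).1 oU _ Unu.
by apply: filterS (Fnu e e0) => mu /eU/UA.
Qed.

Hypothesis compact_M : compact [set: M].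
Hypothesis normal_M : normal_space M.

(** Compactness gives a cluster point [nu]; as [dist] induces the topology, indices with distance to
    [nu] below [k.+1%:R^-1] form a convergent subsequence. *)
Lemma weakstar_subsequence (u : nat -> prob) :
  exists2 t : nat -> nat, {homo t : i j / (i < j)%N} &
  exists nu : prob, (u \o t) @ \oo --> (nu : weakstar R M).
Proof.
have [nu [_ clnu]] : [set: weakstar R M] `&`
    cluster ((u : nat -> weakstar R M) @ \oo) !=set0.
  by apply: weakstar_compact => //; exact: filterT.
have [t ht tnu] : exists2 t : nat -> nat, {homo t : i j / (i < j)%N} &
    forall k, dist nu (u (t k)) < k.+1%:R^-1.
  apply: (increasing_choice (P := fun k j => dist nu (u j) < k.+1%:R^-1)) => k n.
  have un : (u @ \oo) (u @` [set j | (n <= j)%N]).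
    by exists n => // j /= nj; exists j.
  have nbk : nbhs (nu : weakstar R M) (dist_nbhd dist k.+1%:R^-1 nu).
    apply: open_nbhs_nbhs; split; first exact: open_dist_nbhd.
    by rewrite /dist_nbhd/= dist_refl.
  by have [_ [[j /= nj <-] uj]] := clnu _ _ un nbk; exists j.
exists t => //; exists nu; apply/weakstar_cvg_dist => e e0.
have [N _ Ne] := near_infty_natSinv_lt (PosNum e0).
by exists N => // k /= Nk; apply: lt_trans (tnu k) (Ne _ Nk).
Qed.

End weakstar_metric.

(** * Integrals against empirical measures and their continuity in the point *)

Section empirical_measures.
Context (R : realType) (M : ptopologicalType) (f : M -> M).
Hypothesis compact_M : compact [set: M].

Lemma Rintegral_empirical (g : M -> R) x n : continuous g ->
  \int[empirical R f x n]_y g y =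
  n.+1%:R^-1 * \sum_(j < n.+1) g (iter j f x).
Proof.
move=> cg.
have [B gB] := continuous_compact_bounded compact_M cg.
have g0 y : 0 <= g y + B.
  by rewrite -lerBlDr sub0r; have := gB y; rewrite ler_norml => /andP[].
have cgB : continuous (fun y => g y + B).
  by move=> y; apply: cvgD; [exact: cg|exact: cvg_cst].
have mgB := continuous_borel_measurable cgB.
(* Integration against scaled and summed measures is done for the nonnegative [g + B]; the constant
   averages to [B] on both sides and cancels. *)
have : \int[empirical R f x n]_y (g y + B) =
    n.+1%:R^-1 * \sum_(j < n.+1) (g (iter j f x) + B).
  rewrite /Rintegral /empirical ge0_integral_mscale//; last 2 first.
  - exact/measurable_EFinP.
  - by move=> y _; rewrite lee_fin.
  rewrite ge0_integral_measure_sum//; last 2 first.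
  - by move=> y _; rewrite lee_fin.
  - exact/measurable_EFinP.
  rewrite (eq_bigr (fun j : 'I_n.+1 => (g (iter j f x) + B)%:E)); last first.
    move=> j _; rewrite integral_dirac//; last exact/measurable_EFinP.
    by rewrite diracT mul1e.
  by rewrite sumEFin.
rewrite RintegralD// ?Rintegral_prob_cst//; last 2 first.
- exact: continuous_integrable.
- exact: finite_measure_integrable_cst.
rewrite big_split/= sumr_const card_ord mulrDr -[B *+ _]mulr_natl mulrA.
by rewrite mulVf ?pnatr_eq0// mul1r => /addIr.
Qed.

Hypothesis f_continuous : continuous f.

Lemma continuous_iter j : continuous (iter j f).
Proof.
elim: j => [|j IH] x; first exact: cvg_id.
by apply: continuous_comp; [exact: IH|exact: f_continuous].
Qed.

Lemma continuous_empirical n :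
  continuous (fun x => empirical R f x n : weakstar R M).
Proof.
move=> x; apply/weakstar_cvgP => g cg.
rewrite -(eq_cvg _ _ (fun y => esym (Rintegral_empirical y n cg))).
rewrite (Rintegral_empirical x n cg).
apply: cvgMr; apply: cvg_big => [|j _]; first exact: add_continuous.
by apply: continuous_comp; [exact: continuous_iter|exact: cg].
Qed.

End empirical_measures.

(** * Observability of limit measures *)

Section observable_limits.
Context (R : realType) (M : ptopologicalType).
Local Notation prob := (probability (borel M) R).
Variables (dist : prob -> prob -> R) (f : M -> M) (m : prob).
Hypothesis dist_weakstar : weakstar_metric dist.
Hypothesis compact_M : compact [set: M].
Hypothesis normal_M : normal_space M.
Hypothesis f_continuous : continuous f.

(** Observability of [mu] means that this set has positive [m]-measure for every [e > 0]. *)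
Definition near_limit (e : R) (mu : prob) : set (borel M) :=
  [set x | limit_measures f x `&` dist_nbhd dist e mu !=set0].

Lemma open_empirical_ball mu n e :
  open [set x : M | dist mu (empirical R f x n) < e].
Proof.
have /continuousP := @continuous_empirical R M f compact_M f_continuous n.
by move=> /(_ _ (open_dist_nbhd dist_weakstar e mu)).
Qed.

(** A limit measure in the open ball leaves a margin [j.+1%:R^-1]; conversely the margin keeps the
    limit of a subsequence, given by compactness, inside the ball. The right-hand side is built
    countably from open sets, so the set is Borel. *)
Lemma near_limitE e mu : near_limit e mu =
  \bigcup_j \bigcap_n \bigcup_(k in [set k | (n <= k)%N])
    [set x | dist mu (empirical R f x k) < e - j.+1%:R^-1].
Proof.
have [[_ _ dsym tri] _] := dist_weakstar.
apply/seteqP; split=> x.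
- move=> [nu [[s hs snu]]]; rewrite /dist_nbhd/= => mu_nu.
  have d0 : 0 < e - dist mu nu by rewrite subr_gt0.
  have [j _ /(_ _ (leqnn j))/= je] := near_infty_natSinv_lt (PosNum d0).
  exists j => // n _.
  have d1 : 0 < e - j.+1%:R^-1 - dist mu nu by rewrite addrAC subr_gt0.
  have [N _ Nsnu] := (weakstar_cvg_dist dist_weakstar nu _).1 snu _ d1.
  pose k := maxn n N; exists (s k).
    exact: leq_trans (leq_maxl n N) (homo_ltn_ge_id hs k).
  have := Nsnu k (leq_maxr n N); rewrite /= ltrBrDl => /(le_lt_trans _); apply.
  exact: tri.
- move=> [j _ xj].
  have [s hs xs] := @increasing_choice
    (fun _ k => dist mu (empirical R f x k) < e - j.+1%:R^-1)
    (fun _ n => let: ex_intro2 k nk xk := xj n Logic.I in ex_intro2 _ _ k nk xk).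
  have [t ht [nu stnu]] := weakstar_subsequence dist_weakstar compact_M normal_M
    (fun k => empirical R f x (s k)).
  exists nu; split.
    by exists (s \o t) => // i k /ht/hs.
  rewrite /dist_nbhd/=.
  have j0 : 0 < j.+1%:R^-1 :> R by rewrite invr_gt0.
  have [N _ Nnu] := (weakstar_cvg_dist dist_weakstar nu _).1 stnu _ j0.
  have := Nnu N (leqnn N); rewrite /= dsym => Nst.
  apply: le_lt_trans (tri _ (empirical R f x (s (t N))) _) _.
  by rewrite -(subrK j.+1%:R^-1 e) ltrD.
Qed.

Lemma measurable_near_limit e mu : measurable (near_limit e mu).
Proof.
rewrite near_limitE; apply: bigcupT_measurable => j.
apply: bigcapT_measurable => n; apply: bigcup_measurable => k _.
apply: open_borel_measurable; exact: open_empirical_ball.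
Qed.

Lemma second_countable_dense : @second_countable M ->
  exists xs : nat -> M, forall U : set M, open U -> U !=set0 -> exists i, U (xs i).
Proof.
move=> [B /countable_injP[h hinj] [_ Bbasis]].
(* [xs i] lies in the basic set numbered [i], or is the default [point] if that set is empty or
   absent. *)
pose xs i := xget point [set x | exists2 U, B U /\ h U = i & U x].
exists xs => O oO [x Ox].
have [U [BU Ux] UO] := Bbasis x O (open_nbhs_nbhs (conj oO Ox)).
exists (h U); rewrite /xs; case: xgetP => [y _ [V [BV hVU] Vy]|/(_ x)].
  by apply: UO; rewrite -(hinj V U) ?inE.
by case; exists U.
Qed.

Lemma ae_limit_measures_observable : @second_countable M ->
  {ae m, forall x, limit_measures f x `<=` observable dist m f}.
Proof.
move=> /second_countable_dense[xs xsP].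
have [[_ _ dsym tri] _] := dist_weakstar.
(* Countably many balls centred at empirical measures of the dense sequence; [G0] keeps only the
   null sets among the [G i n j]. *)
pose G i n j := near_limit j.+1%:R^-1 (empirical R f (xs i) n).
pose G0 i n j := if m (G i n j) == 0%E then G i n j else set0.
have nG0 i n j : m.-negligible (G0 i n j).
  rewrite /G0; case: eqP => [mG0|_]; last exact: negligible_set0.
  by exists (G i n j); split=> //; exact: measurable_near_limit.
have : m.-negligible (\bigcup_i \bigcup_n \bigcup_j G0 i n j).
  by do 3 apply: negligible_bigcup => ?.
apply: negligibleS => x /= /existsNP[nu /not_implyP[xnu]].
move=> /existsNP[e /not_implyP[e0 /negP]]; rewrite -leNgt => me.
have {me} me0 : m (near_limit e nu) = 0%E.
  by apply/eqP; rewrite eq_le me measure_ge0.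
have e20 : 0 < e / 2 by rewrite divr_gt0.
have [j _ /(_ _ (leqnn j))/= je] := near_infty_natSinv_lt (PosNum e20).
have j0 : 0 < j.+1%:R^-1 :> R by rewrite invr_gt0.
have [s hs snu] := xnu.
have [N _ /(_ _ (leqnn N))/= Nnu] :=
  (weakstar_cvg_dist dist_weakstar nu _).1 snu _ j0.
(* The points whose empirical measure of index [s N] is this close to [nu] form an open set
   containing [x], which the dense sequence meets. *)
have [i /= nu_i] := xsP _ (open_empirical_ball nu (s N) j.+1%:R^-1)
  (ex_intro _ x Nnu).
(* The new centre and the points of its ball are each within [e / 2], so the small ball lies in the
   null ball around [nu]. *)
have GA : G i (s N) j `<=` near_limit e nu.
  move=> y [xi [yxi]]; rewrite /dist_nbhd/= => ixi; exists xi; split=> //.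
  rewrite /dist_nbhd/=; apply: le_lt_trans (tri _ (empirical R f (xs i) (s N)) _) _.
  by rewrite (splitr e) ltrD// (lt_trans _ je).
exists i => //; exists (s N) => //; exists j => //; rewrite /G0.
have -> : m (G i (s N) j) = 0%E.
  by apply: subset_measure0 GA me0; exact: measurable_near_limit.
by rewrite eqxx; exists nu; split=> //; rewrite /dist_nbhd/= dsym.
Qed.

End observable_limits.

(** * Subadditive potentials *)

Section subadditive.
Context (R : realType) (M : ptopologicalType) (f : M -> M) (phi : nat -> M -> R).
Hypothesis compact_M : compact [set: M].
Hypothesis phi_subadditive : subadditive_potential f phi.

(** Splitting off one iterate at a time leaves orbit values of [phi 1], which is bounded by
    compactness. *)
Lemma subadditive_sup_le : exists B : R,
  forall n y, (0 < n)%N -> phi n y <= n%:R * B.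
Proof.
have [cphi sub] := phi_subadditive.
have [B HB] := continuous_compact_bounded compact_M (cphi 1 isT).
exists B; elim=> // -[_ y _|n IH y _].
  by rewrite mul1r (le_trans (ler_norm _)).
rewrite -[n.+2]addn1 natrD mulrDl mul1r; apply: le_trans (sub _ _ _ _ _) _ => //.
by apply: lerD; [exact: IH|rewrite (le_trans (ler_norm _))].
Qed.

(* [T n], the sum of [phi i x] for [n < i <= n + N], telescopes:
   [T n.+1 - T n = phi (n + N).+1 x - phi n.+1 x <= phi N (iter n.+1 f x)]. *)
Lemma subadditive_le_orbit_sum (N : nat) (x : M) : (0 < N)%N ->
  exists C : R, forall n, (N <= n)%N ->
    N%:R * phi n x <= C + \sum_(j < n.+1) phi N (iter j f x).
Proof.
move=> N0; have [cphi sub] := phi_subadditive.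
have /choice[b Hb] : forall r, exists b : R, forall y, (0 < r)%N -> `|phi r y| <= b.
  case=> [|r]; first by exists 0.
  have [B HB] := continuous_compact_bounded compact_M (cphi r.+1 isT).
  by exists B => y _.
pose B := \sum_(r < N.+1) `|b r|.
have B0 : 0 <= B by exact: sumr_ge0.
have phiB r y : (0 < r <= N)%N -> `|phi r y| <= B.
  move=> /andP[r0 rN]; apply: le_trans (Hb r y r0) _.
  apply: le_trans (ler_norm _) _.
  have rN' : (r < N.+1)%N by [].
  rewrite /B (bigD1 (Ordinal rN'))//= lerDl; exact: sumr_ge0.
pose S n := \sum_(j < n) phi N (iter j f x).
pose T n := \sum_(i < N) phi (n + i.+1)%N x.
have TS n : T n.+1 <= T n + phi N (iter n.+1 f x).
  have TD : phi n.+1 x + T n.+1 = T n + phi (n.+1 + N)%N x.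
    rewrite /T [in RHS](eq_bigr (fun i : 'I_N => phi (n.+1 + i)%N x)); last first.
      by move=> i _; rewrite addnS.
    rewrite -(big_ord_recr N (fun i => phi (n.+1 + i)%N x)) big_ord_recl addn0.
    by congr (_ + _); apply: eq_bigr => i _; rewrite /bump/= add1n.
  have := sub n.+1 N x isT N0; lra.
(* The telescoping starts at the first iterate but [S] at [x] itself, whence the correction
   [phi N x]. *)
have TnS n : T n <= T 0%N - phi N x + S n.+1.
  elim: n => [|n IH]; first by rewrite /S big_ord1 subrK.
  apply: le_trans (TS n) _.
  by rewrite /S big_ord_recr/= addrA lerD2r.
(* [phi (n + N)] exceeds each of the [N] terms of [T n] by at most [B], because the remaining block
   is shorter than [N]. The last term has no remaining block and is treated apart, as subadditivity
   concerns positive indices. *)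
have phiT n : N%:R * phi (n + N)%N x <= T n + N%:R * B.
  have sumc (c : R) : N%:R * c = \sum_(i < N) c.
    by rewrite sumr_const card_ord mulr_natl.
  rewrite !sumc /T -big_split/=; apply: ler_sum => i _.
  have [iN|Ni] := ltnP i.+1 N; last first.
    have -> : (n + N = n + i.+1)%N.
      by congr addn; apply/eqP; rewrite eqn_leq Ni ltn_ord.
    by rewrite lerDl.
  have d0 : (0 < N - i.+1)%N by rewrite subn_gt0.
  have -> : (n + N = n + i.+1 + (N - i.+1))%N by rewrite -addnA subnKC// ltnW.
  apply: le_trans (sub _ _ _ _ d0) _; first by rewrite addnS.
  rewrite lerD2l (le_trans (ler_norm _))// phiB// d0 leq_subr//.
(* [phiT] is applied at [n - N]; extending the orbit sum by the [N] missing terms costs the second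
   [N%:R * B]. *)
exists (N%:R * B + N%:R * B + T 0%N - phi N x) => n Nn.
have SN : S (n - N).+1 <= S n.+1 + N%:R * B.
  have : forall k l, S k <= S (k + l)%N + l%:R * B.
    move=> k; elim=> [|l IH]; first by rewrite addn0 mul0r addr0.
    rewrite addnS {2}/S big_ord_recr/= -/(S _).
    have := phiB N (iter (k + l) f x); rewrite N0 leqnn => /(_ isT).
    rewrite ler_norml => /andP[+ _]; rewrite -natr1; lra.
  by move=> /(_ (n - N).+1 N); rewrite addSn subnK.
have := phiT (n - N)%N; have := TnS (n - N)%N; rewrite subnK//.
rewrite -/(S n.+1); lra.
Qed.

End subadditive.

(* Fatou's lemma for the nonnegative functions [B - phi n / n]. *)
Lemma integral_neg_of_growth_neg (R : realType) (M : ptopologicalType)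
    (P : probability (borel M) R) (phi : nat -> M -> R) (B : R) :
  compact [set: M] -> (forall n, (0 < n)%N -> continuous (phi n)) ->
  (forall n y, (0 < n)%N -> phi n y <= n%:R * B) ->
  {ae P, forall x, cvgn (growth phi x) /\ (growth_rate phi x < 0)%E} ->
  exists2 N, (0 < N)%N & \int[P]_x phi N x < 0.
Proof.
move=> cM cphi phiB [Z [mZ Z0 Zgood]]; apply: contrapT => noN.
have int_ge0 n : 0 <= \int[P]_x phi n.+1 x.
  by rewrite leNgt; apply/negP => lt0; apply: noN; exists n.+1.
pose h n (y : borel M) := B - n.+1%:R^-1 * phi n.+1 y.
have h0 n y : 0 <= h n y.
  by rewrite subr_ge0 mulrC ler_pdivrMr// mulrC phiB.
have ch n : continuous (h n : M -> R).
  by move=> y; apply: cvgB; [exact: cvg_cst|apply: cvgMr; exact: cphi].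
have int_h n : (\int[P]_x (h n x)%:E <= B%:E)%E.
  have iphi : P.-integrable setT (EFin \o phi n.+1).
    by apply: continuous_integrable => //; exact: cphi.
  have ih : P.-integrable setT (EFin \o h n) by exact: continuous_integrable.
  rewrite -[leLHS]fineK; last exact: integrable_fin_num.
  rewrite lee_fin -/(Rintegral P setT (h n)) RintegralB//; last 2 first.
  - exact: finite_measure_integrable_cst.
  - apply: continuous_integrable => // y.
    by apply: cvgMr; exact: cphi.
  rewrite Rintegral_prob_cst RintegralZl// lerBlDl lerDr mulr_ge0//.
pose G y := limn_einf (fun n => (h n y)%:E).
have mh n : measurable_fun [set: borel M] (fun y => (h n y)%:E).
  apply/measurable_EFinP; exact: continuous_borel_measurable.
have mG : measurable_fun [set: borel M] G.
  rewrite /G /limn_einf; apply: measurableT_comp => //.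
  by apply: measurable_fun_limn_esup => n; exact: measurableT_comp.
have intG : (\int[P]_x G x <= B%:E)%E.
  apply: le_trans (fatou _ _ mh _) _ => //.
    by move=> n x _; rewrite lee_fin.
  rewrite limn_einf_lim; apply: lime_le; first exact: is_cvg_einfs.
  apply: nearW => n; apply: le_trans (int_h n).
  by apply: ereal_inf_lbound; exists n => /=.
(* Off [Z] the lower limit is [B] minus the negative growth rate; it is infinite when that rate
   is. *)
have GB y : ~ Z y -> (B%:E < G y)%E.
  move=> nZ; have [cg lt0] : cvgn (growth phi y) /\ (growth_rate phi y < 0)%E.
    by apply: contrapT => /Zgood.
  have cvgh : (fun n => (h n y)%:E) @ \oo --> (B%:E - growth_rate phi y)%E.
    suff : (fun n => B%:E - growth phi y n.+1)%E @ \oo --> (B%:E - growth_rate phi y)%E.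
      apply: cvg_trans; apply: near_eq_cvg; apply: nearW => n.
      by rewrite /growth /h -EFinB mulrC.
    apply: cvgeB; [|exact: cvg_cst|].
      by rewrite fin_num_adde_defr.
    by move: cg; rewrite -(cvg_shiftS).
  rewrite /G (cvg_limn_einf_sup cvgh).
  by case: (growth_rate phi y) lt0 => [r| |]//=; rewrite ?ltry// !lte_fin ltrDl oppr_gt0.
(* [K] is positive off the null set [Z], yet its integral will be at most 0, which forces the whole
   space to be null. *)
pose K y := maxe 0%E (G y - B%:E)%E.
(* The assumed nonnegative integral of [phi 1] yields this sign, so that the integral of [K + B]
   splits into nonnegative parts. *)
have B0 : 0 <= B.
  apply: le_trans (int_ge0 0) _; rewrite -[leRHS](Rintegral_prob_cst P).
  apply: le_Rintegral => //.
  - by apply: continuous_integrable => //; exact: cphi.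
  - exact: finite_measure_integrable_cst.
  - by move=> y _; rewrite (le_trans (phiB 1 y isT))// mul1r.
have mK : measurable_fun [set: borel M] K.
  apply: measurable_maxe => //; apply: emeasurable_funB => //.
have K0 y : (0 <= K y)%E by rewrite le_max lexx.
have GK y : ~ Z y -> G y = (K y + B%:E)%E.
  move=> /GB By; rewrite /K max_r ?subeK// sube_ge0 ?ltW//.
have intK : (\int[P]_x K x <= 0)%E.
  have -> : (0 = B%:E - B%:E :> \bar R)%E by rewrite subee.
  rewrite leeBrDr//.
  have intB : (\int[P]_x (cst B%:E x) = B%:E)%E.
    by rewrite integral_cst// [X in (_ * X)%E](@probability_setT _ _ R P) mule1.
  rewrite -[X in (_ + X)%E]intB -ge0_integralD//.
  apply: le_trans _ intG; rewrite le_eqVlt; apply/orP; left; apply/eqP.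
  apply: ge0_ae_eq_integral => //.
  - by apply: emeasurable_funD => //; exact: measurable_cst.
  - by move=> x _; rewrite adde_ge0 ?lee_fin.
  - move=> x _; rewrite /G limn_einf_lim; apply: lime_ge.
      exact: is_cvg_einfs.
    apply: nearW => n; apply: le_ereal_inf_tmp => _ [k _ <-].
    by rewrite lee_fin.
  - exists Z; split=> // x /= /not_implyP[_ nGK]; apply: contrapT => /GK.
    by move=> GKx; apply: nGK; rewrite GKx.
have [N [mN N0 KN]] : ae_eq P setT K (cst 0%E).
  apply/ae_eq_integral_abs => //.
  under eq_integral do rewrite gee0_abs//.
  by apply/eqP; rewrite eq_le intK integral_ge0.
have ZN : setT `<=` Z `|` N.
  move=> x _; have [Zx|nZ] := pselect (Z x); [by left|right].
  apply: KN => /= /(_ Logic.I) Kx0; have := GB x nZ.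
  by rewrite (GK x nZ) Kx0 add0e ltxx.
have : P setT = 0%E.
  have [W [mW W0 ZNW]] : P.-negligible (Z `|` N).
    by apply: negligibleU; exact/negligibleP.
  by apply: subset_measure0 (subset_trans ZN ZNW) W0.
by move/eqP; rewrite [X in X == _](@probability_setT _ _ R P) onee_eq0.
Qed.

Theorem corollary3p3 (R : realType) (M : ptopologicalType) (d : nat)
  (A : set (chart R M d)) (M_manifold : compact_manifold A)
  (m : probability (borel M) R) (m_lebesgue : lebesgue_on A m)
  (dist : probability (borel M) R -> probability (borel M) R -> R)
  (dist_weakstar : weakstar_metric dist)
  (f : M -> M) (f_continuous : continuous f)
  (phi : nat -> M -> R) (phi_subadditive : subadditive_potential f phi)
  (growth_neg : forall mu : probability (borel M) R, observable dist m f mu ->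
     {ae mu, forall x, cvgn (growth phi x) /\ (growth_rate phi x < 0)%E}) :
  {ae m, forall x, (largest_growth_rate phi x < 0)%E}.
Proof.
have [compact_M hausdorff_M countable_M _] := M_manifold.
have normal_M : normal_space M by exact: compact_normal.
have [B phiB] := subadditive_sup_le compact_M phi_subadditive.
have := ae_limit_measures_observable m dist_weakstar compact_M normal_M
  f_continuous countable_M.
apply: negligibleS => x /=; apply: contra_not => obs_x; rewrite ltNge; apply/negP => lim_ge0.
(* At index 0 the quotient is 0 by convention; below, only indices [n >= N > 0] are used. *)
have [s hs slow] : exists2 s : nat -> nat, {homo s : i j / (i < j)%N} &
    forall k, - k.+1%:R^-1 < phi (s k) x / (s k)%:R.
  apply: (increasing_choice
    (P := fun k j => - k.+1%:R^-1 < phi j x / j%:R)) => k n.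
  have esup_ge0 : (0 <= esups (growth phi x) n)%E.
    apply: le_trans lim_ge0 _; rewrite /largest_growth_rate limn_esup_lim.
    rewrite (cvg_lim (@ereal_hausdorff R) (@cvg_esups_inf R (growth phi x))).
    by apply: ereal_inf_lbound; exists n.
  have : ((- k.+1%:R^-1)%:E < esups (growth phi x) n)%E.
    by apply: lt_le_trans esup_ge0; rewrite lte_fin oppr_lt0 invr_gt0.
  move=> /ereal_sup_gt[_ [j /= nj <-]]; rewrite lte_fin => kj.
  by exists j.
have [t ht [nu stnu]] := weakstar_subsequence dist_weakstar compact_M normal_M
  (fun k => empirical R f x (s k)).
have hst : {homo s \o t : i j / (i < j)%N} by move=> i j /ht/hs.
have nu_obs : observable dist m f nu by apply: obs_x; exists (s \o t).
have [N N0 phiN] := integral_neg_of_growth_neg compact_M phi_subadditive.1 phiB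
  (growth_neg nu nu_obs).
have [C phiC] := subadditive_le_orbit_sum compact_M phi_subadditive x N0.
(* The limit integral is [-2 * eta], so the integrals along the subsequence eventually fall below
   [- eta]. *)
pose eta := - (\int[nu]_y phi N y) / 2.
have eta0 : 0 < eta by rewrite divr_gt0// oppr_gt0.
have cphiN := phi_subadditive.1 N N0.
have int_lt : \forall k \near \oo,
    \int[empirical R f x (s (t k))]_y phi N y < - eta.
  have lt_eta : \int[nu]_y phi N y < - eta by rewrite /eta; lra.
  exact: (cvgr_lt _ ((weakstar_cvgP _ _).1 stnu _ cphiN) _ lt_eta).
(* Chosen so that [N%:R * e = eta / 2]: then [N%:R * phi n x] exceeds [- (eta / 2) * n%:R], while
   [C] plus the orbit sum falls below it once [C <= eta / 2 * n%:R]. *)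
pose e := eta / (2 * N%:R).
have NR0 : 0 < N%:R :> R by rewrite ltr0n.
have e0 : 0 < e by rewrite divr_gt0// mulr_gt0.
near \oo => k.
pose n := s (t k).
have kn : (k <= n)%N by exact: (homo_ltn_ge_id hst k).
have Nn : (N <= n)%N by apply: leq_trans kn; near: k; exists N.
have n0 : 0 < n%:R :> R by rewrite ltr0n (leq_trans N0).
have n1 : 0 < n.+1%:R :> R by rewrite ltr0n.
(* The empirical measure of index [n] averages [n.+1] points; the extra [- eta] only strengthens the
   bound. *)
have orbit_sum_lt : \sum_(j < n.+1) phi N (iter j f x) < - eta * n.+1%:R.
  rewrite -ltr_pdivrMr// mulrC -Rintegral_empirical//.
  by rewrite /n; near: k; exact: int_lt.
have phi_gt : - e * n%:R < phi n x.
  rewrite -ltr_pdivlMr//; apply: lt_trans (slow (t k)).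
  rewrite ltrN2; apply: le_lt_trans (_ : k.+1%:R^-1 < e).
    by rewrite lef_pV2 ?posrE// ler_nat ltnS homo_ltn_ge_id.
  by near: k; exact: near_infty_natSinv_lt (PosNum e0).
have C_small : C <= eta / 2 * n%:R.
  rewrite mulrC -ler_pdivrMr; last exact: divr_gt0.
  apply: (@le_trans _ _ k%:R); last by rewrite ler_nat.
  by near: k; exact: nbhs_infty_ger.
have phi_ge : - (eta / 2) * n%:R < N%:R * phi n x.
  have -> : - (eta / 2) * n%:R = N%:R * (- e * n%:R).
    by rewrite /e; field; rewrite gt_eqF.
  by rewrite ltr_pM2l.
have := phiC n Nn; apply/negP; rewrite -ltNge.
rewrite -natr1 in orbit_sum_lt; lra.
Unshelve. all: by end_near. Qed.
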